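(* Let $N>1$ be an integer. Then $$\sum_{j\in \mathbb{Z}/N} W_j = \psi(N),\qquad \text{where } \psi(N):=N\prod_{p\mid N}\left(1+\frac1p\right),$$ $$\sum_{j\in(\mathbb{Z}/N)^*} W_j = N,$$ $$\sum_{j\in\mathbb{Z}/N,\ \gcd(j,N)>1} W_j=\psi(N)-N.$$
   Context: Here $\mathbb{N}=\mathbb{Z}_{>0}$, $\mathbb{Z}/N=\mathbb{Z}/N\mathbb{Z}$, and $(\mathbb{Z}/N)^*$ is its group of units. The function $W:\mathbb{Z}/N\to\mathbb{N}$, $j\mapsto W_j$, is defined by $$W_j=\min\{m\in\mathbb{N}\mid mj-1\in(\mathbb{Z}/N)^*\}.$$ The product over $p\mid N$ runs over the primes $p$ dividing $N$. By convention $\gcd(0,N)=N$. *)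

(* Defs.v *)
From mathcomp Require Import all_boot all_order all_algebra.

Set Implicit Arguments.
Unset Strict Implicit.
Unset Printing Implicit Defensive.

Import GRing.Theory.
Local Open Scope ring_scope.

(* ['Z_N] is Z/N only for [1 < N]. The minimum defining [W] is over a nonempty
   set: [m] equal to the modulus works, since [-1] is a unit. *)
Lemma W_exists (N : nat) (j : 'Z_N) :
  exists m : nat, (0 < m)%N && (m%:R * j - 1 \is a GRing.unit).
Proof.
exists (Zp_trunc N).+2; rewrite /=.
have -> : (Zp_trunc N).+2%:R = 0 :> 'Z_N by exact: (@pchar_Zp (Zp_trunc N).+2).
by rewrite mul0r sub0r unitrN unitr1.
Qed.

Definition W (N : nat) (j : 'Z_N) : nat := ex_minn (W_exists j).

Definition psi (N : nat) : rat :=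
  N%:R * \prod_(p <- primes N) (1 + p%:R^-1).

(* Main.v *)
(* On the pairs (x, y) over Z/N with gcd(x, y, N) = 1, consider the bijection
   f(x, y) = (x, y - x).  If y is a unit, then the first return time of
   (j y, y) to the set {y unit} is W_j, since y - m j y = -(m j - 1) y.
   Every orbit of f meets this set, so (Kac's lemma) the return times add up to
   the number of pairs: phi(N) * sum_j W_j = J_2(N) = phi(N) psi(N).  The same
   count on the invariant subset {x unit}, which has phi(N) * N elements, gives
   the sum over the units j. *)

Require Import Defs.
From mathcomp Require Import all_boot all_order all_algebra.
From mathcomp Require Import ring.

Local Open Scope ring_scope.

Import GRing.Theory Num.Theory.

(** * Return times of an injection on a finite set *)

(* Kac's lemma.  On [X] the return time satisfies
   [R x = 1 + (if f x is in S then 0 else R (f x))]; sum this over [X]. *)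
Lemma sum_return_time (T : finType) (f : T -> T) (S X : pred T) (R : T -> nat) :
  injective f -> {subset S <= X} -> (forall x, X (f x) = X x) ->
  (forall x, X x -> [/\ (0 < R x)%N, S (iter (R x) f x) &
     forall m, (0 < m)%N -> S (iter m f x) -> (R x <= m)%N]) ->
  (\sum_(x | S x) R x = \sum_(x | X x) 1)%N.
Proof.
move=> f_inj sSX Xf RP.
have Rf x : X x -> (R x = (if S (f x) then 0 else R (f x)) + 1)%N.
  move=> Xx; have [R0 SR Rmin] := RP _ Xx.
  have Xfx : X (f x) by rewrite Xf.
  have [R0' SR' Rmin'] := RP _ Xfx.
  case: ifPn => Sfx; first by apply/eqP; rewrite eqn_leq R0 andbT; apply: Rmin.
  rewrite addn1; apply/eqP; rewrite eqn_leq Rmin ?iterSr //=.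
  case: (R x) R0 SR => // -[|k] _; first by rewrite /= (negPf Sfx).
  by rewrite iterSr ltnS; apply: Rmin'.
have sumR : (\sum_(x | X x) R x =
    \sum_(x | X x) (if S x then 0 else R x) + \sum_(x | X x) 1)%N.
  rewrite [in RHS](reindex_inj f_inj) /= (eq_bigl _ _ Xf) -big_split /=.
  exact: eq_bigr.
(* The points of [X] outside [S] contribute the same amount to both sides and cancel. *)
rewrite (bigID S) /= in sumR; move/eqP: sumR.
rewrite (eq_bigl S) => [|x]; last first.
  by rewrite andbC; case Sx: (S x) => //=; apply: sSX.
have -> : (\sum_(x | X x) (if S x then 0 else R x) =
    \sum_(x | X x && ~~ S x) R x)%N.
  by rewrite [RHS]big_mkcondr /=; apply: eq_bigr => x _; case: (S x).
by rewrite addnC eqn_add2l => /eqP.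
Qed.

(** * Evaluation of Jordan's totient J_2 *)

Lemma sum_nat_periodic (F : nat -> nat) (p M : nat) :
  (forall k i, F (k * M + i)%N = F i) ->
  (\sum_(0 <= i < p * M) F i = p * \sum_(0 <= i < M) F i)%N.
Proof.
move=> per; rewrite big_nat_mul (eq_bigr (fun=> \sum_(0 <= i < M) F i)%N).
  by rewrite sum_nat_const_nat subn0.
move=> k _; rewrite -{1}[(k * M)%N]add0n big_addn mulSn addnK.
by apply: eq_bigr => i _; rewrite addnC per.
Qed.

Lemma sum_nat_dvdn (F : nat -> nat) (p M : nat) : (0 < p)%N ->
  (\sum_(0 <= i < p * M) (p %| i) * F i = \sum_(0 <= i < M) F (p * i))%N.
Proof.
case: p => // p _; rewrite mulnC big_nat_mul; apply: eq_bigr => k _.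
(* In each block of [p.+1] consecutive indices only the first is a multiple of [p.+1]. *)
rewrite -{1}[(k * p.+1)%N]add0n big_addn mulSn addnK big_nat_recl //=.
rewrite add0n dvdn_mull // mul1n mulnC big_nat_cond big1 ?addn0 // => i.
case/andP=> /andP[_ lt_ip] _; rewrite dvdn_addl ?dvdn_mulr ?dvdn_mull //.
by rewrite gtnNdvd.
Qed.

(* Jordan's totient J_2: the number of elements of order [N] in (Z/N)^2. *)
Definition jordan2 (N : nat) : nat :=
  (\sum_(0 <= x < N) \sum_(0 <= y < N) coprime (gcdn x y) N)%N.

Lemma coprime_gcdnMD (N k x y : nat) :
  coprime (gcdn (k * N + x) y) N = coprime (gcdn x y) N.
Proof.
rewrite /coprime -!gcdnA ![gcdn y N]gcdnC !gcdnA; congr (gcdn _ _ == _).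
by rewrite ![gcdn _ N]gcdnC gcdnMDl.
Qed.

(** Being coprime to [N] is periodic mod [N] in each coordinate, so the square of side [p * N]
    splits into [p ^ 2] copies of the square of side [N]. *)
Lemma sum_coprime_gcdn (p N : nat) :
  (\sum_(0 <= x < p * N) \sum_(0 <= y < p * N) coprime (gcdn x y) N
    = p ^ 2 * jordan2 N)%N.
Proof.
rewrite sum_nat_periodic => [|k i]; last first.
  by apply: eq_bigr => y _; rewrite coprime_gcdnMD.
rewrite -mulnA; congr (_ * _)%N; rewrite /jordan2 big_distrr /=.
apply: eq_bigr => x _; rewrite sum_nat_periodic // => k i.
by rewrite gcdnC coprime_gcdnMD gcdnC.
Qed.

Lemma coprime_primeM (p N m : nat) : prime p ->
  coprime m (p * N) = ~~ (p %| m)%N && coprime m N.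
Proof. by move=> pp; rewrite coprimeMr coprime_sym prime_coprime. Qed.

Lemma coprime_dvd_prime (p N m : nat) : prime p -> (p %| N)%N ->
  coprime m (p * N) = coprime m N.
Proof.
move=> pp pN; rewrite coprimeMr; apply/andb_idl.
by apply: coprime_dvdr.
Qed.

Lemma jordan2_dvd (p N : nat) : prime p -> (p %| N)%N ->
  jordan2 (p * N) = (p ^ 2 * jordan2 N)%N.
Proof.
move=> pp pN; rewrite -sum_coprime_gcdn; apply: eq_bigr => x _.
by apply: eq_bigr => y _; rewrite coprime_dvd_prime.
Qed.

(* Among the pairs mod [p * N] with [gcd(x, y, N) = 1], those not coprime to [p]
   are the [(p x', p y')], where [(x', y')] is counted by [jordan2 N]. *)
Lemma jordan2_ndvd (p N : nat) : prime p -> ~~ (p %| N)%N ->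
  (jordan2 (p * N) + jordan2 N = p ^ 2 * jordan2 N)%N.
Proof.
move=> pp npN; have p0 := prime_gt0 pp.
have {1}-> : (jordan2 N = \sum_(0 <= x < p * N) (p %| x) *
    \sum_(0 <= y < p * N) (p %| y) * coprime (gcdn x y) N)%N.
  rewrite sum_nat_dvdn //; apply: eq_bigr => x _.
  rewrite sum_nat_dvdn //; apply: eq_bigr => y _.
  by rewrite -muln_gcdr coprimeMl (prime_coprime _ pp) npN.
rewrite -big_split -sum_coprime_gcdn; apply: eq_bigr => x _.
rewrite big_distrr -big_split /=; apply: eq_bigr => y _.
rewrite coprime_primeM // dvdn_gcd.
by case: (p %| x)%N; case: (p %| y)%N; case: coprime.
Qed.

Lemma totient_dvd (p N : nat) : prime p -> (p %| N)%N ->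
  totient (p * N) = (p * totient N)%N.
Proof.
move=> pp pN; rewrite !totient_count_coprime -sum_nat_periodic => [|k i].
  by apply: eq_bigr => i _; rewrite !(coprime_sym _ i) coprime_dvd_prime.
by rewrite /coprime gcdnMDl.
Qed.

Lemma psi_dvd (p N : nat) : prime p -> (0 < N)%N -> (p %| N)%N ->
  psi (p * N) = p%:R * psi N.
Proof.
move=> pp N0 pN; rewrite /psi natrM -mulrA; congr (_ * (_ * _)).
apply: perm_big; apply: uniq_perm; rewrite ?primes_uniq // => q.
rewrite primesM ?(prime_gt0 pp) // primes_prime // inE.
by case: eqVneq => //= ->; rewrite mem_primes pp N0 pN.
Qed.

Lemma psi_ndvd (p N : nat) : prime p -> (0 < N)%N -> ~~ (p %| N)%N ->
  psi (p * N) = p.+1%:R * psi N.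
Proof.
move=> pp N0 npN; rewrite /psi natrM.
rewrite (perm_big (p :: primes N)) /=.
  have p0 : p%:R != 0 :> rat by rewrite pnatr_eq0 -lt0n prime_gt0.
  by rewrite big_cons -natr1; field.
apply: uniq_perm; rewrite /= ?primes_uniq ?mem_primes ?(negPf npN) ?andbF //.
by move=> q; rewrite primesM ?(prime_gt0 pp) // primes_prime // !inE.
Qed.

(** Induction, removing one prime [p] from [N = p * M]: both sides gain the factor p^2 if p divides
    M, and p^2 - 1 = (p - 1)(p + 1) otherwise. *)
Lemma jordan2E (N : nat) : (0 < N)%N ->
  (jordan2 N)%:R = (totient N)%:R * psi N :> rat.
Proof.
elim/ltn_ind: N => N IH N0; have [N1|N1] := leqP N 1.
  have -> : N = 1%N by apply/eqP; rewrite eqn_leq N1.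
  by rewrite /jordan2 /psi !big_nat1 big_nil mulr1.
have pp := pdiv_prime N1; have /dvdnP[M eN] := pdiv_dvd N.
move: (pdiv N) pp eN => p pp; rewrite mulnC => eN; subst N.
have p0 := prime_gt0 pp; have M0 : (0 < M)%N by move: N0; rewrite muln_gt0 p0.
have {IH} IH : (jordan2 M)%:R = (totient M)%:R * psi M :> rat.
  by apply: IH => //; rewrite ltn_Pmull ?prime_gt1.
have [pM|npM] := boolP (p %| M)%N.
  by rewrite jordan2_dvd // totient_dvd // psi_dvd // !natrM IH; ring.
rewrite totient_coprime ?prime_coprime // totient_prime // psi_ndvd //.
have /(congr1 (fun k => k%:R : rat)) := jordan2_ndvd _ _ pp npM.
rewrite natrD !natrM => /(canRL (addrK _)) ->.
by rewrite IH -(prednK p0) -!natr1 /=; ring.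
Qed.

(** * Orbits that reach a unit second coordinate *)

(* Every prime dividing [N] divides exactly one of [y] and [m], where [m] is
   the product of the primes dividing [N] but not [y]. *)
Lemma coprime_shift (N x y : nat) : (0 < N)%N -> coprime (gcdn x y) N ->
  exists m, coprime N (y + m * x).
Proof.
move=> N0 cop; pose m := (\prod_(p <- primes N | ~~ (p %| y)) p)%N.
exists m; apply: contraT => /eqP g1; set g := gcdn _ _ in g1.
have g0 : (0 < g)%N by rewrite gcdn_gt0 N0.
have {g1} g1 : (1 < g)%N by rewrite ltn_neqAle eq_sym g0 andbT; apply/eqP.
have pp := pdiv_prime g1; have := pdiv_dvd g; rewrite dvdn_gcd.
move: (pdiv g) pp => p pp {g g0 g1} /andP[pN].
have pNs : p \in primes N by rewrite mem_primes pp N0.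
have pm : (p %| m)%N = ~~ (p %| y)%N.
  rewrite Euclid_dvd_prod // big_has_cond; apply/hasP/idP => [[q]|npy].
    rewrite mem_primes => /andP[pq _] /andP[].
    by rewrite (dvdn_prime2 pp pq) => npy /eqP->.
  by exists p => //=; rewrite npy dvdnn.
have [py|npy] := boolP (p %| y)%N; last first.
  by rewrite dvdn_addl ?dvdn_mulr ?pm // (negPf npy).
rewrite dvdn_addr // Euclid_dvdM // pm py /= => px.
have : (p %| gcdn (gcdn x y) N)%N by rewrite !dvdn_gcd px py.
by rewrite (eqP cop) Euclid_dvd1.
Qed.

Lemma coprime_shiftP (N x y : nat) : (0 < N)%N ->
  reflect (exists m, coprime N (y + m * x)) (coprime (gcdn x y) N).
Proof.
move=> N0; apply: (iffP idP) => [|[m cop]]; first exact: coprime_shift.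
rewrite coprime_sym; apply: coprime_dvdr cop.
by rewrite dvdn_add ?dvdn_mull ?dvdn_gcdl ?dvdn_gcdr.
Qed.

(** The m-th iterate of f sends (x, y) to (x, y - m x), so the pairs counted by [jordan2] are
    exactly those whose orbit reaches a unit second coordinate. *)
Lemma coprime_gcdn_ZpP (n : nat) (x y : 'Z_n.+2) :
  reflect (exists m : nat, y - x *+ m \is a GRing.unit)
    (coprime (gcdn x y) n.+2).
Proof.
have unitE m : (y + x *+ m \is a GRing.unit) = coprime n.+2 (y + m * x).
  by rewrite -unitZpE // natrD natrM !natr_Zp mulr_natl.
have opp m : exists k : nat, x *+ k = - (x *+ m).
  (* The witness is the representative of -m in [0, N), read as a natural number. *)
  exists (- m%:R : 'Z_n.+2).
  by rewrite -[LHS]mulr_natl natr_Zp mulNr mulr_natl.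
apply: (iffP (coprime_shiftP _ _ _ (ltn0Sn _))) => [] [m];
  have [k kE] := opp m.
- by rewrite -unitE => u; exists k; rewrite kE opprK.
- by rewrite -kE unitE => u; exists k.
Qed.

Lemma unit_ZpE (n : nat) (j : 'Z_n.+2) :
  (j \is a GRing.unit) = coprime n.+2 j.
Proof. by rewrite -[in LHS](natr_Zp j) unitZpE. Qed.

Lemma card_unit_Zp (n : nat) :
  #|[pred u : 'Z_n.+2 | u \is a GRing.unit]| = totient n.+2.
Proof.
rewrite -sum1_card big_mkcond totient_count_coprime big_mkord.
by apply: eq_bigr => u _; rewrite inE unit_ZpE; case: coprime.
Qed.

(** * Return times and the sums of [W] *)

(** Kac's lemma on the pairs with first coordinate in [P]. Invariance of [P] allows the substitution
    x = j y for each unit y, so every y contributes the same sum. [P] will be everything, then the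
    units. *)
Lemma sum_W_unit_invariant (n : nat) (P : pred 'Z_n.+2) :
  (forall x u, u \is a GRing.unit -> P (x * u) = P x) ->
  (totient n.+2 * \sum_(j | P j) W j =
   \sum_(v : 'Z_n.+2 * 'Z_n.+2 | P v.1 && coprime (gcdn v.1 v.2) n.+2) 1)%N.
Proof.
move=> Punit; pose f (v : 'Z_n.+2 * 'Z_n.+2) := (v.1, v.2 - v.1).
pose X := [pred v : 'Z_n.+2 * 'Z_n.+2 | P v.1 & coprime (gcdn v.1 v.2) n.+2].
pose S := [pred v : 'Z_n.+2 * 'Z_n.+2 | P v.1 & v.2 \is a GRing.unit].
have iterf m v : iter m f v = (v.1, v.2 - v.1 *+ m).
  elim: m => [|m /= ->]; first by case: v => x y; rewrite mulr0n subr0.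
  by rewrite /f /= mulrSr opprD addrA.
have mulrn_period (z : 'Z_n.+2) m : z *+ (m + n.+2) = z *+ m.
  by rewrite mulrnDr -(mulr_natl z n.+2) pchar_Zp // mul0r addr0.
have Xf v : X (f v) = X v.
  case: v => x y; congr (_ && _).
  apply/(coprime_gcdn_ZpP _ x (y - x))/(coprime_gcdn_ZpP _ x y) => [] [m].
    by exists m.+1; rewrite mulrS opprD addrA.
  (* This is [m - 1] modulo the period [n.+2], which also covers [m = 0]. *)
  move=> u; exists (m + n.+1)%N.
  by rewrite -addrA -opprD -mulrS -addnS mulrn_period.
have sSX : {subset S <= X}.
  case=> x y /andP[Px u]; apply/andP; split=> //.
  by apply/coprime_gcdn_ZpP; exists 0%N; rewrite mulr0n subr0.
(* [X v ==> _] makes the return time total, with junk value 1 outside [X]. *)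
have exR v : exists m, (0 < m)%N && (X v ==> S (iter m f v)).
  have [Xv|_] /= := boolP (X v); last by exists 1%N.
  have /andP[Pv /coprime_gcdn_ZpP[m u]] := Xv.
  (* A full period is added because [m] may be 0, while a return time is positive. *)
  by exists (m + n.+2)%N; rewrite addnS iterf /= Pv -addnS mulrn_period.
pose R v := ex_minn (exR v).
have RP v : X v -> [/\ (0 < R v)%N, S (iter (R v) f v) &
     forall m, (0 < m)%N -> S (iter m f v) -> (R v <= m)%N].
  rewrite /R; case: ex_minnP => m /andP[m0 Sm] min Xv.
  rewrite Xv in Sm; split=> // k k0 Sk; apply: min.
  by rewrite k0 Sk implybT.
rewrite -(@sum_return_time _ f S X R) //; last first.
  case=> x y [x' y'] e; have /= ex := congr1 fst e.
  by have /= := congr1 snd e; rewrite ex => /addIr ->.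
have -> : (\sum_(v | S v) R v =
    \sum_(y : 'Z_n.+2 | y \is a GRing.unit) \sum_(x | P x) R (x, y))%N.
  by rewrite exchange_big pair_big; apply: eq_bigr => -[].
have RW j y : P j -> y \is a GRing.unit -> R (j * y, y) = W j.
  move=> Pj uy; have Xjy : X (j * y, y).
    by apply: sSX; rewrite inE; apply/andP; split=> //; rewrite Punit.
  have SE m : S (iter m f (j * y, y)) = (m%:R * j - 1 \is a GRing.unit).
    have e : y - (j * y) *+ m = - ((m%:R * j - 1) * y).
      by rewrite mulrBl mul1r opprB -mulrA mulr_natl.
    by rewrite iterf [LHS]/= e unitrN unitrM uy andbT Punit // Pj.
  have [R0 SR min] := RP _ Xjy.
  rewrite /W; case: ex_minnP => m /andP[m0 um] minW.
  apply/eqP; rewrite eqn_leq min ?SE // minW // R0 /=.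
  by rewrite -SE.
rewrite -card_unit_Zp -sum_nat_const; apply: eq_bigr => y uy.
rewrite [RHS](reindex_inj (mulIr uy)) /= [RHS](eq_bigl P) => [|j]; last first.
  exact: Punit.
by apply: eq_bigr => j Pj; rewrite RW.
Qed.

Theorem proposition1p6 (N : nat) (hN : (1 < N)%N) :
  [/\ (\sum_(j : 'Z_N) W j)%:R = psi N :> rat,
      (\sum_(j : 'Z_N | j \is a GRing.unit) W j)%N = N
    & (\sum_(j : 'Z_N | (1 < gcdn j N)%N) W j)%:R = psi N - N%:R :> rat].
Proof.
case: N hN => [|[|n]] // _.
have t0 : (0 < totient n.+2)%N by rewrite totient_gt0.
have sumT : (\sum_(j : 'Z_n.+2) W j)%:R = psi n.+2 :> rat.
  apply: (@mulfI _ (totient n.+2)%:R); first by rewrite pnatr_eq0 -lt0n.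
  rewrite -natrM sum_W_unit_invariant // -jordan2E //; congr _%:R.
  rewrite /jordan2 big_mkord big_mkcond /=.
  under [RHS]eq_bigr => x _ do rewrite big_mkord.
  by rewrite pair_big; apply: eq_bigr => v _ /=; case: coprime.
have sumU : (\sum_(j : 'Z_n.+2 | j \is a GRing.unit) W j)%N = n.+2.
  apply/eqP; rewrite -(eqn_pmul2l t0) sum_W_unit_invariant => [|x u uu]; last first.
    by rewrite unitrM uu andbT.
  (* A unit first coordinate makes the gcd condition automatic, leaving phi(N) * N pairs. *)
  rewrite (eq_bigl (fun v : 'Z_n.+2 * 'Z_n.+2 =>
    (v.1 \is a GRing.unit) && true)) => [|[x y] /=]; last first.
    apply: andb_id2l; rewrite unit_ZpE coprime_sym => cop.
    exact: coprime_dvdl (dvdn_gcdl _ _) cop.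
  rewrite -(pair_big (fun x : 'Z_n.+2 => x \is a GRing.unit) predT
    (fun _ _ => 1%N)) /=.
  rewrite sum1_card card_ord sum_nat_const.
  by rewrite -card_unit_Zp.
split=> //; rewrite -sumT.
rewrite [in RHS](bigID (fun j : 'Z_n.+2 => j \is a GRing.unit)) /= sumU.
rewrite natrD addrC addKr; congr _%:R; apply: eq_bigl => j.
rewrite unit_ZpE /coprime gcdnC.
(* The gcd is positive, so differing from 1 means exceeding 1. *)
by case: (gcdn n.+2 j) (gcdn_gt0 n.+2 j) => [|[|g]].
Qed.
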